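(* Let $k\ge 2$. For every $k$-uniform hypergraph $H$ on $n$ vertices, $\mathrm{mc}_k(H)\leq n-\alpha_k^*(H)$.
   Context: Hypergraphs are finite with nonempty vertex set. The shadow-graph $H^{(2)}$ of a hypergraph $H$ is the graph on $V(H)$ in which $\{x,y\}$ is an edge if and only if some $e\in E(H)$ satisfies $\{x,y\}\subseteq e$. $H$ is connected if $H^{(2)}$ is connected, and the components of $H$ are its maximal connected subgraphs (so an isolated vertex is a component on one vertex). An $r$-coloring of $H$ is a partition $\{E_1,\dots,E_r\}$ of $E(H)$ in which some of the sets may be empty. A monochromatic component of $H$ (with respect to this coloring) is a component of the hypergraph $(V(H),E_i)$ for some $i\in\{1,\dots,r\}$. $\mathrm{mc}_r(H)$ is the largest integer $m$ such that in every $r$-coloring of the edges of $H$ there is a monochromatic component on at least $m$ vertices. The $k$-partite-hole number $\alpha_k^*(H)$ is the maximum integer $a$ such that there exist pairwise disjoint sets $X_1,\dots,X_k\subseteq V(H)$ with $|X_1|=\dots=|X_k|=a$ such that for every $e\in E(H)$ there is $i\in\{1,\dots,k\}$ with $e\cap X_i=\emptyset$. *)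

(* Defs.v *)
From mathcomp Require Import all_boot.

Set Implicit Arguments.
Unset Strict Implicit.
Unset Printing Implicit Defensive.

(* A hypergraph with vertex set V is given by its edge set E : {set {set V}}. *)
(* A subhypergraph is a pair (W, F) of a vertex set and an edge set.          *)

Definition uniform (V : finType) (k : nat) (E : {set {set V}}) : bool :=
  [forall e in E, #|e| == k].

(* Adjacency in the shadow-graph. *)
Definition shadow (V : finType) (E : {set {set V}}) : rel V :=
  fun x y => (x != y) && [exists e in E, [set x; y] \subset e].

Definition is_hypergraph (V : finType) (G : {set V} * {set {set V}}) : bool :=
  (G.1 != set0) && [forall e in G.2, e \subset G.1].

(* The edges of G lie within G.1, so paths of the shadow-graph that start in  *)
(* G.1 stay in G.1.                                                           *)
Definition connected_hypergraph (V : finType) (G : {set V} * {set {set V}}) :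
    bool :=
  is_hypergraph G &&
  [forall x in G.1, forall y in G.1, connect (shadow G.2) x y].

Definition subhypergraph (V : finType) (G G' : {set V} * {set {set V}}) :
    bool :=
  (G.1 \subset G'.1) && (G.2 \subset G'.2).

Definition component (V : finType) (G C : {set V} * {set {set V}}) : bool :=
  [&& subhypergraph C G, connected_hypergraph C
    & [forall C' : {set V} * {set {set V}},
        [&& subhypergraph C' G, connected_hypergraph C' & subhypergraph C C']
        ==> (C' == C)]].

Definition coloring (V : finType) (r : nat) (E : {set {set V}})
    (c : {ffun 'I_r -> {set {set V}}}) : bool :=
  (\bigcup_i c i == E) &&
  [forall i, forall j, (i != j) ==> [disjoint c i & c j]].

Definition monochromatic_component (V : finType) (r : nat)
    (c : {ffun 'I_r -> {set {set V}}}) (C : {set V} * {set {set V}}) : bool :=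
  [exists i, component ([set: V], c i) C].

Definition has_large_mono (V : finType) (r : nat) (E : {set {set V}})
    (m : nat) : bool :=
  [forall c : {ffun 'I_r -> {set {set V}}}, coloring E c ==>
    [exists C, monochromatic_component c C && (m <= #|C.1|)]].

(* The range bound loses nothing when V is nonempty and r > 0: see mcP. *)
Definition mc (V : finType) (r : nat) (E : {set {set V}}) : nat :=
  \max_(m < #|V|.+1 | has_large_mono r E m) m.

Definition has_partite_hole (V : finType) (k : nat) (E : {set {set V}})
    (a : nat) : bool :=
  [exists X : {ffun 'I_k -> {set V}},
    [&& [forall i, forall j, (i != j) ==> [disjoint X i & X j]],
        [forall i, #|X i| == a]
      & [forall e in E, exists i, e :&: X i == set0]]].

(* The range bound loses nothing when k > 0: see partite_holeP. *)
Definition partite_hole (V : finType) (k : nat) (E : {set {set V}}) : nat :=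
  \max_(a < #|V|.+1 | has_partite_hole k E a) a.

Lemma bigmax_largest (N : nat) (P : pred nat) :
  P 0 -> (forall m, P m -> m <= N) ->
  P (\max_(m < N.+1 | P m) m) /\
  (forall m, P m -> m <= \max_(m < N.+1 | P m) m).
Proof.
move=> P0 PN; split.
  have [|i Pi Ei] := @eq_bigmax_cond _ [pred m : 'I_N.+1 | P m] val.
    by apply/card_gt0P; exists ord0.
  by rewrite [X in P X]Ei.
by move=> m Pm; apply: (@leq_bigmax_cond _ _ _ (Ordinal (PN m Pm : m < N.+1))).
Qed.

Lemma component_exists (V : finType) (E : {set {set V}}) (v : V) :
  exists C, component ([set: V], E) C.
Proof.
pose P C := subhypergraph C ([set: V], E) && connected_hypergraph C.
pose C0 : {set V} * {set {set V}} := ([set v], set0).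
have P0 : P C0.
  apply/andP; split; first by rewrite /subhypergraph subsetT sub0set.
  apply/andP; split.
    apply/andP; split; first by apply/set0Pn; exists v; rewrite set11.
    by apply/forall_inP => e; rewrite inE.
  by do 2![apply/forall_inP => ? /set1P ->]; apply: connect0.
have [C PC Cmax] :=
  arg_maxnP (fun C : {set V} * {set {set V}} => #|C.1| + #|C.2|) P0.
exists C; case/andP: (PC) => CE Cc; rewrite /component CE Cc /=.
apply/forallP => C'; apply/implyP => /and3P[C'E C'c /andP[s1 s2]].
have := Cmax C'; rewrite /P C'E C'c => /(_ isT) le.
have l1 := subset_leq_card s1; have l2 := subset_leq_card s2.
rewrite -pair_eqE /pair_eq /= !(eq_sym _ (C.1)) !(eq_sym _ (C.2)).
rewrite !eqEcard s1 s2 /=.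
apply/andP; split.
  by rewrite -(leq_add2r #|C'.2|); apply: leq_trans le _; rewrite leq_add2l.
by rewrite -(leq_add2l #|C'.1|); apply: leq_trans le _; rewrite leq_add2r.
Qed.

Lemma coloring_exists (V : finType) (r : nat) (E : {set {set V}}) :
  0 < r -> exists c : {ffun 'I_r -> {set {set V}}}, coloring E c.
Proof.
move=> r0; pose i0 := Ordinal r0.
exists [ffun i => if i == i0 then E else set0]; apply/andP; split.
  rewrite (bigD1 i0) //= ffunE eqxx big1 ?setU0 //.
  by move=> i /negPf ni; rewrite ffunE ni.
apply/forallP => i; apply/forallP => j; apply/implyP; rewrite !ffunE -setI_eq0.
case: ifP => [/eqP->|_]; case: ifP => [/eqP->|_];
  by rewrite ?set0I ?setI0 ?eqxx ?implybT.
Qed.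

Lemma mcP (V : finType) (r : nat) (E : {set {set V}}) :
  0 < #|V| -> 0 < r ->
  has_large_mono r E (mc r E) /\
  (forall m, has_large_mono r E m -> m <= mc r E).
Proof.
move=> /card_gt0P[v _] r0; apply: bigmax_largest => [|m].
  apply/forallP => c; apply/implyP => _.
  have [C CP] := component_exists (c (Ordinal r0)) v.
  by apply/existsP; exists C; rewrite andbT; apply/existsP; exists (Ordinal r0).
have [c cP] := coloring_exists E r0.
move=> /forallP/(_ c); rewrite cP => /existsP[C /andP[_ le]].
exact: leq_trans le (max_card _).
Qed.

Lemma partite_holeP (V : finType) (k : nat) (E : {set {set V}}) :
  0 < k ->
  has_partite_hole k E (partite_hole k E) /\
  (forall a, has_partite_hole k E a -> a <= partite_hole k E).
Proof.
move=> k0; apply: bigmax_largest => [|a].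
  apply/existsP; exists [ffun=> set0]; apply/and3P; split.
  - apply/forallP => i; apply/forallP => j; apply/implyP => _.
    by rewrite !ffunE -setI_eq0 setI0.
  - by apply/forallP => i; rewrite ffunE cards0.
  - apply/forall_inP => e _; apply/existsP; exists (Ordinal k0).
    by rewrite ffunE setI0.
move=> /existsP[X /and3P[_ /forallP/(_ (Ordinal k0))/eqP <- _]].
exact: max_card.
Qed.

Lemma partite_hole_le (V : finType) (k : nat) (E : {set {set V}}) :
  partite_hole k E <= #|V|.
Proof. by apply/bigmax_leqP => a _; rewrite -ltnS. Qed.

(* Main.v *)
(* Given a k-partite hole X_1, ..., X_k of size a, color each edge with some i
   such that the edge misses X_i. In color i every vertex of X_i is isolated,
   so a monochromatic component is a single vertex or misses some X_i. *)
Require Import Defs.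
From mathcomp Require Import all_boot.

(** A nontrivial shadow path from [x] would begin with an edge through [x]. *)
Lemma connected_hypergraph_isolated (V : finType)
    (G : {set V} * {set {set V}}) (x : V) :
  connected_hypergraph G -> x \in G.1 ->
  (forall e, e \in G.2 -> x \notin e) -> G.1 = [set x].
Proof.
case/andP=> _ /forall_inP Gconn xG xiso.
apply/eqP; rewrite eqEsubset sub1set xG andbT.
apply/subsetP => y yG; rewrite inE.
have /connectP[[|z p] /= pxy ->] := forall_inP (Gconn x xG) y yG.
  exact: eqxx.
have /andP[/andP[_ /existsP[e /andP[eG xze]]] _] := pxy.
by have /negP[] := xiso e eG; rewrite (subsetP xze) ?set21.
Qed.

(** The 1 in the maximum covers a component that meets [X], which is then a lone vertex. *)
Lemma card_component_avoiding (V : finType) (F : {set {set V}}) (X : {set V})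
    (C : {set V} * {set {set V}}) :
  component ([set: V], F) C -> (forall e, e \in F -> e :&: X = set0) ->
  #|C.1| <= maxn 1 (#|V| - #|X|).
Proof.
case/and3P=> /andP[_ /= CF] Cconn _ FX.
have [CX|] := boolP [disjoint C.1 & X].
  rewrite leq_max; apply/orP; right.
  (* The double complement lets [#|V| - #|X|] be read as the size of [~: X]. *)
  by rewrite -[X]setCK -cardsCs subset_leq_card // -disjoints_subset.
case/pred0Pn=> x /andP[/= xC xX].
rewrite (connected_hypergraph_isolated _ C x) ?cards1 ?leq_maxl //.
move=> e /(subsetP CF)/FX /setP/(_ x); rewrite !inE.
by rewrite (_ : x \in X) // andbT => ->.
Qed.

(** Since [2 <= k], two disjoint sets of size [a] fit into [V], so [a + a <= #|V|]. Strictness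
    leaves room for single-vertex components in the final bound. *)
Lemma has_partite_hole_ltn (V : finType) (k : nat) (E : {set {set V}})
    (a : nat) :
  2 <= k -> 0 < #|V| -> has_partite_hole k E a -> a < #|V|.
Proof.
move=> k2 V0 /existsP[X /and3P[/forallP Xdisj /forallP Xcard _]].
have [->//|a0] := posnP a.
pose i0 := Ordinal (ltnW k2); pose i1 := Ordinal k2.
have /implyP/(_ isT) X01 := forallP (Xdisj i0) i1.
have := max_card (X i0 :|: X i1).
move: X01; rewrite -leq_card_setU => /eqP ->.
rewrite (eqP (Xcard i0)) (eqP (Xcard i1)); apply: leq_trans.
by rewrite -addn1 leq_add2l.
Qed.

Lemma has_partite_hole_coloring (V : finType) (k : nat) (E : {set {set V}})
    (a : nat) :
  has_partite_hole k E a ->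
  exists (X : {ffun 'I_k -> {set V}}) (c : {ffun 'I_k -> {set {set V}}}),
    [/\ coloring E c, forall i, #|X i| = a
      & forall i e, e \in c i -> e :&: X i = set0].
Proof.
case/existsP=> X /and3P[_ /forallP Xcard /forall_inP Xhole].
(* An edge may miss several of the sets; picking one index makes the color classes disjoint. *)
pose f (e : {set V}) := [pick i | e :&: X i == set0].
exists X, [ffun i => [set e in E | f e == Some i]]; split.
- apply/andP; split.
    apply/eqP/setP => e; apply/bigcupP/idP => [[i _]|eE].
      by rewrite ffunE inE => /andP[].
    have /existsP[j ej] := Xhole e eE.
    have [i fe] : exists i, f e = Some i.
      by rewrite /f; case: pickP => [i _|/(_ j)]; [exists i | rewrite ej].
    by exists i; rewrite // ffunE inE eE fe /=.
  apply/forallP => i; apply/forallP => j; apply/implyP => /eqP ij.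
  apply/pred0P => e /=; rewrite !ffunE !inE; apply/negP.
  by case/andP=> /andP[_ /eqP ->] /andP[_ /eqP[]].
- by move=> i; apply/eqP.
- move=> i e; rewrite ffunE inE /f => /andP[_].
  by case: pickP => // j /eqP ej /eqP[<-].
Qed.

Theorem proposition1p1 (k n : nat) (V : finType) (E : {set {set V}}) :
  2 <= k -> 0 < #|V| -> #|V| = n -> uniform k E ->
  mc k E <= n - partite_hole k E.
Proof.
move=> k2 V0 <- _.
have [hole _] := partite_holeP E (ltnW k2).
have aV := has_partite_hole_ltn _ _ _ _ k2 V0 hole.
have [X [c [cE Xcard cX]]] := has_partite_hole_coloring _ _ _ _ hole.
(* Applied to [c], the defining property of [mc k E] yields a component on at least that many
   vertices. *)
have [/forallP/(_ c) + _] := mcP E V0 (ltnW k2).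
rewrite cE => /existsP[C /andP[/existsP[i Ccomp] /leq_trans->//]].
have := card_component_avoiding _ _ _ _ Ccomp (cX i).
(* By [aV] the difference is at least 1, so it is the maximum. *)
by rewrite Xcard (maxn_idPr _) // subn_gt0.
Qed.
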